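(* Let $q\in\mathbb{C}$ with $0<|q|<1$, and let $x,y,z,w\in\mathbb{C}$ satisfy $|y|<1$, $|q|<|x|<1/|y|$, $w\neq 0$, and, for all $r\in\mathbb{N}$, $z\neq q^{-r}$, $w\neq q^{-r}$ and $z\neq wq^{-r-1}$. Then $$A(x,y,z,w)-\frac{zq}{xw}A\left(xy,\frac{q}{x},\frac{zq}{w},z\right)=L(xy,z,w)+yL\left(y,\frac{zq}{w}\right)L(xy,w)-\frac{zq}{xw}L\left(\frac{q}{x},\frac{zq}{w}\right)L(xy,z).$$
   Context: $\mathbb{N}=\{0,1,2,\dots\}$, and $q$ is complex with $0<|q|<1$. The double Lambert series is $$A(x,y,z,w)=A(x,y,z,w;q):=\sum_{n=0}^\infty\sum_{m\ge n}\frac{x^n y^m}{(1-wq^n)(1-zq^m)},$$ defined for $|xy|<1$, $|y|<1$, $z\ne q^{-r}$, $w\neq q^{-r}$ ($r\in\mathbb{N}$). The Lambert series is $$L(x,y_1,\dots,y_k)=L(x,y_1,\dots,y_k;q):=\sum_{n=0}^\infty\frac{x^n}{(1-y_1q^n)\cdots(1-y_kq^n)},$$ defined for $|x|<1$ and $y_i\ne q^{-r}$ ($r\in\mathbb{N}$). Here $0^0=1$, and $1/|y|$ is read as $+\infty$ if $y=0$. *)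

(* Defs.v *)
From Stdlib Require Import Reals List.
From Coquelicot Require Import Coquelicot.

Open Scope C_scope.

(* Sum of a complex series. It is built like the library's [RInt], so it equals
   the limit of the partial sums when these converge and is an unspecified
   number otherwise. *)
Definition CSeries (a : nat -> C) : C :=
  iota (T := C_CompleteNormedModule) (is_series (V := C_NormedModule) a).

(* In both series, [Cpow] satisfies [c ^ 0 = 1] for every [c], including [0]. *)

(* The inner index is [m = n + k] with [k] in N. *)
Definition doubleLambert (q x y z w : C) : C :=
  CSeries (fun n => CSeries (fun k =>
    (x ^ n * y ^ (n + k)) / ((1 - w * q ^ n) * (1 - z * q ^ (n + k))))).

(* The list [ys] is the sequence of parameters y_1, ..., y_k. *)
Definition lambert (q x : C) (ys : list C) : C :=
  CSeries (fun n =>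
    x ^ n / fold_right Cmult 1 (map (fun y => 1 - y * q ^ n) ys)).

(* Main.v *)
Require Import Defs.
From Stdlib Require Import Reals List Lra Lia FunctionalExtensionality.
From Coquelicot Require Import Coquelicot.
Import ListNotations.
Open Scope C_scope.

(** Put t = zq/w. In A(x,y,z,w) the terms with m = n give L(xy,z,w). A term
    with m = n + k + 1 has denominator (1 - a)(1 - ra), where a = w q^n and
    r = t q^k, and the partial fraction identity
      1/((1 - a)(1 - ra)) = 1/(1 - r) * (1/(1 - a) - r/(1 - ra))
    ([partial_fraction]) splits it in two. The first part separates the
    variables n and k and sums to y L(y,t) L(xy,w). The second part sums to
    -(t/x) T, where T is the sum of g (n + k + 1) k over all n, k, and
      g N k = (xy)^N (q/x)^k / ((1 - z q^N)(1 - t q^k)).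
    So T is the sum of g over the triangle k < N. The sum of g over the
    complementary triangle k >= N is A(xy,q/x,t,z), and its sum over the whole
    quadrant is the product L(xy,z) L(q/x,t); hence
      T = L(xy,z) L(q/x,t) - A(xy,q/x,t,z),
    which is the theorem.

    The analytic content is the splitting of the quadrant into two triangles
    ([CSeries2_triangles]), which rests on an exchange of summations
    ([CSeries2_swap]). All double families here are bounded by
    c r^n s^k with r, s < 1, because the factors 1/(1 - v q^n) stay bounded
    ([inv_factor_bounded]); for such families a direct estimate of the tails
    is enough to exchange the sums. *)

(** * Sums of complex series *)

Notation is_sum := (is_series (V := C_NormedModule)).
Notation summable := (ex_series (V := C_NormedModule)).

Lemma CSeries_unique (a : nat -> C) (l : C) : is_sum a l -> CSeries a = l.
Proof.
  intros Ha. apply (iota_unique (V := C_CompleteNormedModule)); [|exact Ha].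
  intros l' Ha'.
  exact (filterlim_locally_unique (V := C_NormedModule) _ _ _ Ha' Ha).
Qed.

Lemma CSeries_correct (a : nat -> C) : summable a -> is_sum a (CSeries a).
Proof. intros [l Ha]. now rewrite (CSeries_unique a l Ha). Qed.

Lemma CSeries_ext (a b : nat -> C) :
  (forall n, a n = b n) -> CSeries a = CSeries b.
Proof. intros Hab. f_equal. now apply functional_extensionality. Qed.

Lemma CSeries_plus (a b : nat -> C) : summable a -> summable b ->
  CSeries (fun n => a n + b n) = CSeries a + CSeries b.
Proof.
  intros Ha Hb. apply CSeries_unique.
  now apply (is_series_plus a b); apply CSeries_correct.
Qed.

Lemma CSeries_scal (c : C) (a : nat -> C) : summable a ->
  CSeries (fun n => c * a n) = c * CSeries a.
Proof.
  intros Ha. apply CSeries_unique.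
  now apply (is_series_scal c a); apply CSeries_correct.
Qed.

Lemma summable_ext (a b : nat -> C) :
  (forall n, a n = b n) -> summable b -> summable a.
Proof. intros Hab. apply ex_series_ext. intros n; symmetry; apply Hab. Qed.

Lemma summable_plus (a b : nat -> C) : summable a -> summable b ->
  summable (fun n => a n + b n).
Proof. apply (ex_series_plus a b). Qed.

Lemma summable_scal (c : C) (a : nat -> C) : summable a ->
  summable (fun n => c * a n).
Proof. apply (ex_series_scal c a). Qed.

Lemma CSeries_head (a : nat -> C) : summable a ->
  CSeries a = a 0%nat + CSeries (fun k => a (S k)).
Proof.
  intros Ha. apply CSeries_unique, (is_series_decr_1 a).
  replace (plus _ _) with (CSeries (fun k => a (S k))).
  - now apply CSeries_correct, (ex_series_incr_1 a).
  - change plus with Cplus; change opp with Copp; ring.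
Qed.

Lemma CSeries_skip (a : nat -> C) (N : nat) : summable a ->
  (forall k, (k < N)%nat -> a k = 0) ->
  CSeries a = CSeries (fun k => a (N + k)%nat).
Proof.
  revert a; induction N as [|N IH]; intros a Ha H0; [reflexivity|].
  rewrite (CSeries_head a Ha), H0, Cplus_0_l by lia.
  apply (IH (fun k => a (S k))).
  - now apply (ex_series_incr_1 a).
  - intros k Hk; apply H0; lia.
Qed.

(** * Geometric bounds *)

Lemma is_sum_geom (c s : R) : (0 <= s < 1)%R ->
  is_series (fun k => c * s ^ k)%R (c / (1 - s))%R.
Proof.
  intros Hs. apply (is_series_scal c (fun k => s ^ k)%R), is_series_geom.
  rewrite Rabs_pos_eq; lra.
Qed.

Lemma summable_geom (a : nat -> C) (c s : R) : (0 <= s < 1)%R ->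
  (forall k, Cmod (a k) <= c * s ^ k)%R -> summable a.
Proof.
  intros Hs Ha.
  apply (ex_series_le (V := C_CompleteNormedModule) a (fun k => c * s ^ k)%R Ha).
  eexists; now apply is_sum_geom.
Qed.

Lemma CSeries_geom_le (a : nat -> C) (c s : R) : (0 <= s < 1)%R ->
  (forall k, Cmod (a k) <= c * s ^ k)%R -> (Cmod (CSeries a) <= c / (1 - s))%R.
Proof.
  intros Hs Ha.
  assert (Hl := CSeries_correct a (summable_geom a c s Hs Ha)).
  apply (is_lim_seq_le (fun N => Cmod (sum_n (G := C_AbelianMonoid) a N))
                      (sum_n (fun k => c * s ^ k)%R)
                      (Cmod (CSeries a)) (c / (1 - s))%R).
  - intros N. eapply Rle_trans.
    + apply (norm_sum_n_m (V := C_NormedModule) a 0 N).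
    + apply sum_n_m_le, Ha.
  - eapply filterlim_comp; [exact Hl|].
    apply (filterlim_norm (V := C_NormedModule)).
  - now apply is_sum_geom.
Qed.

(** The recurrence telescopes to a 0 + ... + a N = T 0 - T (N + 1), and the
    remainders T K tend to 0. *)
Lemma is_sum_remainder (a T : nat -> C) (D s : R) : (0 <= s < 1)%R ->
  (forall K, T K = a K + T (S K)) -> (forall K, Cmod (T K) <= D * s ^ K)%R ->
  is_sum a (T 0%nat).
Proof.
  intros Hs HT HD.
  assert (Hsum : forall N, sum_n (G := C_AbelianMonoid) a N = T 0%nat - T (S N)).
  { induction N as [|N IH].
    - rewrite sum_O, (HT 0%nat). change (a 0%nat = a 0%nat + T 1%nat - T 1%nat). ring.
    - rewrite sum_Sn, IH, (HT (S N)).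
      change (T 0%nat - (a (S N) + T (S (S N))) + a (S N) = T 0%nat - T (S (S N))).
      ring. }
  intros P [eps HP].
  assert (H0 : is_lim_seq (fun N => D * s ^ N)%R 0).
  { replace 0%R with (D * 0)%R by ring.
    apply (is_lim_seq_scal_l _ D 0), is_lim_seq_geom; rewrite Rabs_pos_eq; lra. }
  destruct (proj2 (is_lim_seq_spec _ _) H0 eps) as [N0 HN].
  exists N0; intros N HNN. apply HP.
  apply (norm_compat1 (V := C_NormedModule)).
  change (Cmod (sum_n (G := C_AbelianMonoid) a N - T 0%nat) < eps)%R.
  rewrite Hsum. replace (T 0%nat - T (S N) - T 0%nat) with (- T (S N)) by ring.
  rewrite Cmod_opp. eapply Rle_lt_trans; [apply HD|].
  eapply Rle_lt_trans; [apply Rle_abs|].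
  specialize (HN (S N) ltac:(lia)). now rewrite Rminus_0_r in HN.
Qed.

(** * Double series under a geometric bound *)

(** A bound by a product of geometric sequences makes the sequences of row sums
    and of column sums geometrically bounded too, and it survives
    transposition, shifts and restriction to a triangle. *)
Definition geom_dominated (f : nat -> nat -> C) : Prop :=
  exists c r s : R, (0 <= r < 1)%R /\ (0 <= s < 1)%R /\
    forall n k, (Cmod (f n k) <= c * r ^ n * s ^ k)%R.

Definition CSeries2 (f : nat -> nat -> C) : C :=
  CSeries (fun n => CSeries (f n)).

Lemma geom_dominated_swap (f : nat -> nat -> C) :
  geom_dominated f -> geom_dominated (fun k n => f n k).
Proof.
  intros (c & r & s & Hr & Hs & H). exists c, s, r. repeat split; try apply Hr; try apply Hs.
  intros k n. specialize (H n k). lra.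
Qed.

Lemma geom_dominated_le (f g : nat -> nat -> C) :
  (forall n k, Cmod (g n k) <= Cmod (f n k))%R ->
  geom_dominated f -> geom_dominated g.
Proof.
  intros Hgf (c & r & s & Hr & Hs & H). exists c, r, s. repeat split; try apply Hr; try apply Hs.
  intros n k. eapply Rle_trans; [apply Hgf|apply H].
Qed.

Lemma geom_dominated_prod (a b : nat -> C) (ca r cb s : R) :
  (0 <= r < 1)%R -> (0 <= s < 1)%R ->
  (forall n, Cmod (a n) <= ca * r ^ n)%R -> (forall k, Cmod (b k) <= cb * s ^ k)%R ->
  geom_dominated (fun n k => a n * b k).
Proof.
  intros Hr Hs Ha Hb. exists (ca * cb)%R, r, s. repeat split; try apply Hr; try apply Hs.
  intros n k. rewrite Cmod_mult.
  replace (ca * cb * r ^ n * s ^ k)%R with ((ca * r ^ n) * (cb * s ^ k))%R by ring.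
  apply Rmult_le_compat; auto using Cmod_ge_0.
Qed.

(** The extra factor r^(k+1) produced by the shift is at most 1. *)
Lemma geom_dominated_diag (f : nat -> nat -> C) :
  geom_dominated f -> geom_dominated (fun n k => f (n + k + 1)%nat k).
Proof.
  intros (c & r & s & Hr & Hs & H). exists c, r, s. repeat split; try apply Hr; try apply Hs.
  intros n k. eapply Rle_trans; [apply H|].
  assert (Hc : (0 <= c)%R).
  { specialize (H 0%nat 0%nat). pose proof (Cmod_ge_0 (f 0%nat 0%nat)). simpl in H. lra. }
  apply Rmult_le_compat_r; [apply pow_le, Hs|].
  apply Rmult_le_compat_l; [exact Hc|].
  rewrite <- Nat.add_assoc, pow_add. rewrite <- (Rmult_1_r (r ^ n)) at 2.
  apply Rmult_le_compat_l; [apply pow_le, Hr|].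
  rewrite <- (pow1 (k + 1)). apply pow_incr; lra.
Qed.

Lemma geom_dominated_row (f : nat -> nat -> C) (n : nat) :
  geom_dominated f -> summable (f n).
Proof.
  intros (c & r & s & _ & Hs & H).
  exact (summable_geom _ (c * r ^ n) s Hs (H n)).
Qed.

Lemma geom_dominated_sums (f : nat -> nat -> C) :
  geom_dominated f -> summable (fun n => CSeries (f n)).
Proof.
  intros (c & r & s & Hr & Hs & H).
  apply (summable_geom _ (c / (1 - s)) r Hr). intros n.
  replace (c / (1 - s) * r ^ n)%R with (c * r ^ n / (1 - s))%R by (unfold Rdiv; ring).
  exact (CSeries_geom_le _ _ s Hs (H n)).
Qed.

Lemma CSeries2_plus (f g : nat -> nat -> C) :
  geom_dominated f -> geom_dominated g ->
  CSeries2 (fun n k => f n k + g n k) = CSeries2 f + CSeries2 g.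
Proof.
  intros Hf Hg. unfold CSeries2.
  rewrite <- CSeries_plus by now apply geom_dominated_sums.
  apply CSeries_ext; intros n. now apply CSeries_plus; apply geom_dominated_row.
Qed.

(** The double sum over the columns k >= K differs from the one over
    k >= K + 1 by the sum of column K, and it is at most a constant times s^K;
    so these tails are the remainders of the series of column sums. *)
Lemma CSeries2_swap (f : nat -> nat -> C) : geom_dominated f ->
  CSeries2 f = CSeries2 (fun k n => f n k).
Proof.
  intros Hf. symmetry. apply CSeries_unique.
  assert (Hf' := Hf). destruct Hf' as (c & r & s & Hr & Hs & H).
  set (T := fun K => CSeries2 (fun n k => f n (K + k)%nat)).
  assert (Hdom : forall K n k,
    (Cmod (f n (K + k)%nat) <= c * s ^ K * r ^ n * s ^ k)%R).
  { intros K n k. eapply Rle_trans; [apply H|]. rewrite pow_add. right; ring. }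
  assert (HTdom : forall K, geom_dominated (fun n k => f n (K + k)%nat)).
  { intros K. exists (c * s ^ K)%R, r, s. auto. }
  change (is_sum (fun k => CSeries (fun n => f n k)) (T 0%nat)).
  apply (is_sum_remainder _ T (c / (1 - s) / (1 - r))%R s Hs).
  - intros K. unfold T, CSeries2.
    rewrite <- CSeries_plus.
    2: now apply (geom_dominated_row (fun k n => f n k)), geom_dominated_swap.
    2: apply geom_dominated_sums, HTdom.
    apply CSeries_ext; intros n.
    rewrite CSeries_head by (apply (geom_dominated_row _ n (HTdom K))).
    rewrite Nat.add_0_r. f_equal.
    apply CSeries_ext; intros k; f_equal; lia.
  - intros K. unfold T, CSeries2.
    replace (c / (1 - s) / (1 - r) * s ^ K)%R
      with (c / (1 - s) * s ^ K / (1 - r))%R by (unfold Rdiv; ring).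
    apply (CSeries_geom_le _ _ r Hr). intros n.
    replace (c / (1 - s) * s ^ K * r ^ n)%R
      with (c * s ^ K * r ^ n / (1 - s))%R by (unfold Rdiv; ring).
    apply (CSeries_geom_le _ _ s Hs), Hdom.
Qed.

(** The quadrant is cut into k >= n and k < n. The second triangle is summed
    column by column after an exchange: column k starts at n = k + 1, so
    dropping its zeros gives g (n + k + 1) k, and a second exchange restores
    the order of summation. *)
Lemma CSeries2_triangles (g : nat -> nat -> C) : geom_dominated g ->
  CSeries2 g = CSeries2 (fun n k => g n (n + k)%nat)
             + CSeries2 (fun n k => g (n + k + 1)%nat k).
Proof.
  intros Hg.
  set (up := fun n k => if (k <? n)%nat then RtoC 0 else g n k).
  set (lo := fun n k => if (k <? n)%nat then g n k else RtoC 0).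
  assert (Hup : geom_dominated up).
  { apply (geom_dominated_le g); [|exact Hg]. intros n k. unfold up.
    destruct (k <? n)%nat; [rewrite Cmod_0; apply Cmod_ge_0|apply Rle_refl]. }
  assert (Hlo : geom_dominated lo).
  { apply (geom_dominated_le g); [|exact Hg]. intros n k. unfold lo.
    destruct (k <? n)%nat; [apply Rle_refl|rewrite Cmod_0; apply Cmod_ge_0]. }
  assert (Hdiag : geom_dominated (fun n k => g (n + k + 1)%nat k))
    by now apply geom_dominated_diag.
  transitivity (CSeries2 up + CSeries2 lo).
  { rewrite <- CSeries2_plus by assumption. unfold CSeries2.
    apply CSeries_ext; intros n. apply CSeries_ext; intros k. unfold up, lo. destruct (k <? n)%nat; ring. }
  f_equal.
  - apply CSeries_ext; intros n. rewrite (CSeries_skip (up n) n).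
    + apply CSeries_ext; intros k. unfold up.
      now rewrite (proj2 (Nat.ltb_ge _ _)) by lia.
    + now apply geom_dominated_row.
    + intros k Hk. unfold up. now rewrite (proj2 (Nat.ltb_lt _ _)).
  - rewrite (CSeries2_swap lo Hlo), (CSeries2_swap _ Hdiag).
    apply CSeries_ext; intros k.
    rewrite (CSeries_skip (fun n => lo n k) (S k)).
    + apply CSeries_ext; intros n. unfold lo.
      rewrite (proj2 (Nat.ltb_lt _ _)) by lia. f_equal; lia.
    + exact (geom_dominated_row _ k (geom_dominated_swap _ Hlo)).
    + intros n Hn. unfold lo. now rewrite (proj2 (Nat.ltb_ge _ _)) by lia.
Qed.

Lemma CSeries2_prod (a b : nat -> C) : summable a -> summable b ->
  CSeries2 (fun n k => a n * b k) = CSeries a * CSeries b.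
Proof.
  intros Ha Hb. rewrite Cmult_comm, <- CSeries_scal by exact Ha.
  apply CSeries_ext; intros n. rewrite CSeries_scal by exact Hb. ring.
Qed.

(** * Lambert denominators *)

Lemma seq_bounded (u : nat -> R) (N : nat) : exists B, forall n, (n < N)%nat -> (u n <= B)%R.
Proof.
  induction N as [|N [B HB]].
  - exists 0%R; intros n Hn; lia.
  - exists (Rmax B (u N)). intros n Hn.
    destruct (Nat.eq_dec n N) as [->|]; [apply Rmax_r|].
    eapply Rle_trans; [apply HB; lia|apply Rmax_l].
Qed.

Lemma pole_nonzero (q v : C) (n : nat) : q <> 0 -> v <> (/ q) ^ n ->
  1 - v * q ^ n <> 0.
Proof.
  intros Hq Hv H. apply Hv. assert (Hn := Cpow_nz q n Hq).
  rewrite Cpow_inv by exact Hq.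
  replace v with ((1 - (1 - v * q ^ n)) * / q ^ n) by (field; exact Hn).
  rewrite H. ring.
Qed.

(** Since v q^n tends to 0, all but finitely many of the factors 1 - v q^n
    have modulus at least 1/2. *)
Lemma inv_factor_bounded (q v : C) : (Cmod q < 1)%R ->
  (forall n, 1 - v * q ^ n <> 0) ->
  exists B, forall n, (Cmod (/ (1 - v * q ^ n)) <= B)%R.
Proof.
  intros Hq Hv.
  assert (Hlim : is_lim_seq (fun n => Cmod v * Cmod q ^ n)%R 0).
  { replace 0%R with (Cmod v * 0)%R by ring.
    apply (is_lim_seq_scal_l _ (Cmod v) 0), is_lim_seq_geom.
    now rewrite Rabs_pos_eq by apply Cmod_ge_0. }
  destruct (proj2 (is_lim_seq_spec _ _) Hlim (mkposreal (1/2) ltac:(lra))) as [N HN].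
  destruct (seq_bounded (fun n => Cmod (/ (1 - v * q ^ n))) N) as [B HB].
  exists (Rmax B 2). intros n.
  destruct (Nat.lt_ge_cases n N) as [Hn|Hn].
  { eapply Rle_trans; [now apply HB|apply Rmax_l]. }
  eapply Rle_trans; [|apply Rmax_r].
  specialize (HN n Hn). simpl in HN. rewrite Rminus_0_r in HN.
  assert (Hsmall := Rle_lt_trans _ _ _ (Rle_abs _) HN).
  rewrite <- Cmod_pow, <- Cmod_mult in Hsmall.
  assert (Htri := Cmod_triangle (1 - v * q ^ n) (v * q ^ n)).
  replace (1 - v * q ^ n + v * q ^ n) with (RtoC 1) in Htri by ring.
  rewrite Cmod_1 in Htri.
  rewrite Cmod_inv by apply Hv.
  replace 2%R with (/ (1/2))%R by field.
  apply Rinv_le_contravar; lra.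
Qed.

(** * The double Lambert series identity *)

Lemma partial_fraction (a r : C) : 1 - a <> 0 -> 1 - r * a <> 0 -> 1 - r <> 0 ->
  / ((1 - a) * (1 - r * a)) = / (1 - r) * (/ (1 - a) - r / (1 - r * a)).
Proof. intros; field; auto. Qed.

Theorem mainTheorem4 (q x y z w : C)
  (hq0 : (0 < Cmod q)%R) (hq1 : (Cmod q < 1)%R)
  (hy : (Cmod y < 1)%R)
  (hqx : (Cmod q < Cmod x)%R)
  (hxy : y <> 0 -> (Cmod x < 1 / Cmod y)%R)
  (hw0 : w <> 0)
  (hz : forall r : nat, z <> (/ q) ^ r)
  (hw : forall r : nat, w <> (/ q) ^ r)
  (hzw : forall r : nat, z <> w * (/ q) ^ (r + 1)) :
  doubleLambert q x y z w
    - (z * q) / (x * w) * doubleLambert q (x * y) (q / x) (z * q / w) z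
  = lambert q (x * y) [z; w]
    + y * lambert q y [z * q / w] * lambert q (x * y) [w]
    - (z * q) / (x * w) * lambert q (q / x) [z * q / w] * lambert q (x * y) [z].
Proof.
  assert (Hq : q <> 0) by (now apply Cmod_gt_0).
  assert (Hx : x <> 0) by (apply Cmod_gt_0; lra).
  assert (Hxy : (0 <= Cmod (x * y) < 1)%R).
  { split; [apply Cmod_ge_0|]. rewrite Cmod_mult.
    destruct (Ceq_dec y 0) as [->|Hy]; [rewrite Cmod_0; lra|].
    assert (Hy0 := proj1 (Cmod_gt_0 y) Hy).
    replace 1%R with (1 / Cmod y * Cmod y)%R by (field; lra).
    apply Rmult_lt_compat_r; auto. }
  assert (Hqx : (0 <= Cmod (q / x) < 1)%R).
  { split; [apply Cmod_ge_0|]. rewrite Cmod_div by exact Hx.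
    apply -> Rdiv_lt_1; lra. }
  assert (Hy : (0 <= Cmod y < 1)%R) by (split; [apply Cmod_ge_0|exact hy]).
  set (t := z * q / w).
  replace (z * q / (x * w)) with (t / x) by (unfold t; field; auto).
  assert (Hz : forall n, 1 - z * q ^ n <> 0) by (intros n; now apply pole_nonzero).
  assert (Hw : forall n, 1 - w * q ^ n <> 0) by (intros n; now apply pole_nonzero).
  assert (Ht : forall n, 1 - t * q ^ n <> 0).
  { intros n. apply pole_nonzero; [exact Hq|]. intros E. apply (hzw n).
    rewrite Cpow_add_r, <- E, Cpow_1_r. unfold t. field; auto. }
  destruct (inv_factor_bounded q z hq1 Hz) as [Bz HBz].
  destruct (inv_factor_bounded q w hq1 Hw) as [Bw HBw].
  destruct (inv_factor_bounded q t hq1 Ht) as [Bt HBt].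
  set (u := fun n => / (1 - w * q ^ n)) in *.
  set (v := fun n => / (1 - z * q ^ n)) in *.
  set (p := fun n => / (1 - t * q ^ n)) in *.
  assert (Hbd : forall (c : C) (b : nat -> C) (B : R),
    (forall n, Cmod (b n) <= B)%R ->
    forall n, (Cmod (c ^ n * b n) <= B * Cmod c ^ n)%R).
  { intros c b B Hb n. rewrite Cmod_mult, Cmod_pow, Rmult_comm.
    apply Rmult_le_compat_r; [apply pow_le, Cmod_ge_0|apply Hb]. }
  assert (HBuv : forall n, (Cmod (v n * u n) <= Bz * Bw)%R).
  { intros n. rewrite Cmod_mult.
    apply Rmult_le_compat; [apply Cmod_ge_0|apply Cmod_ge_0|apply HBz|apply HBw]. }
  (* The general terms of L(xy,z), L(q/x,t), L(xy,w), L(y,t) and L(xy,z,w). *)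
  set (a := fun n => (x * y) ^ n * v n).
  set (b := fun k => (q / x) ^ k * p k).
  set (d := fun n => (x * y) ^ n * u n).
  set (e := fun k => y ^ k * p k).
  set (f := fun n => (x * y) ^ n * (v n * u n)).
  assert (Ha := Hbd (x * y) v Bz HBz). fold a in Ha.
  assert (Hb := Hbd (q / x) p Bt HBt). fold b in Hb.
  assert (Hd := Hbd (x * y) u Bw HBw). fold d in Hd.
  assert (He := Hbd y p Bt HBt). fold e in He.
  assert (Hf := Hbd (x * y) (fun n => v n * u n) (Bz * Bw)%R HBuv). fold f in Hf.
  assert (Hsa := summable_geom a _ _ Hxy Ha).
  assert (Hsb := summable_geom b _ _ Hqx Hb).
  assert (Hsd := summable_geom d _ _ Hxy Hd).
  assert (Hse := summable_geom e _ _ Hy He).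
  assert (Hsf := summable_geom f _ _ Hxy Hf).
  set (g := fun n k => a n * b k).
  assert (Hg : geom_dominated g)
    by exact (geom_dominated_prod a b _ _ _ _ Hxy Hqx Ha Hb).
  assert (Hgd := geom_dominated_diag g Hg).
  set (T := CSeries2 (fun n k => g (n + k + 1)%nat k)).
  assert (EL1 : lambert q (x * y) [z; w] = CSeries f).
  { apply CSeries_ext; intros n. unfold f, u, v. simpl.
    field; auto. }
  assert (EL2 : lambert q y [t] = CSeries e).
  { apply CSeries_ext; intros n. unfold e, p. simpl. field; auto. }
  assert (EL3 : lambert q (x * y) [w] = CSeries d).
  { apply CSeries_ext; intros n. unfold d, u. simpl. field; auto. }
  assert (EL4 : lambert q (q / x) [t] = CSeries b).
  { apply CSeries_ext; intros n. unfold b, p. simpl.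
    unfold Cdiv at 1. rewrite Cmult_1_r. reflexivity. }
  assert (EL5 : lambert q (x * y) [z] = CSeries a).
  { apply CSeries_ext; intros n. unfold a, v. simpl. field; auto. }
  assert (EA2 : doubleLambert q (x * y) (q / x) t z
                = CSeries2 (fun n k => g n (n + k)%nat)).
  { apply CSeries_ext; intros n. apply CSeries_ext; intros k.
    unfold g, a, b, v, p. field; auto. }
  assert (EA1 : doubleLambert q x y z w
                = CSeries f + y * CSeries e * CSeries d - t / x * T).
  { (* Partial fractions with a = w q^n and r = t q^k, so that
       r a = z q^(n+k+1); the second part is brought to the form of g by
       y t (xy)^n (yq)^k = (t/x) (xy)^(n+k+1) (q/x)^k. *)
    assert (Hterm : forall n k,
      (x ^ n * y ^ (n + S k)) / ((1 - w * q ^ n) * (1 - z * q ^ (n + S k)))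
      = y * d n * e k + - (t / x) * g (n + k + 1)%nat k).
    { intros n k.
      replace (n + k + 1)%nat with (n + S k)%nat by lia.
      assert (Er : z * q ^ (n + S k) = (t * q ^ k) * (w * q ^ n)).
      { rewrite Cpow_add_r, Cpow_S. unfold t. field; auto. }
      assert (Hnz := Hz (n + S k)%nat).
      unfold Cdiv at 1. unfold g, a, b, d, e, u, v, p.
      rewrite Er in *. rewrite partial_fraction by auto.
      unfold Cdiv. rewrite !Cpow_mult_l, Cpow_inv by exact Hx.
      rewrite !Cpow_add_r, !Cpow_S.
      field. repeat split; auto using Cpow_nz. }
    (* The term k = 0 is the diagonal m = n. *)
    assert (Hinner : forall n,
      CSeries (fun k => (x ^ n * y ^ (n + k)) / ((1 - w * q ^ n) * (1 - z * q ^ (n + k))))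
      = f n + ((y * CSeries e) * d n
               + - (t / x) * CSeries (fun k => g (n + k + 1)%nat k))).
    { intros n.
      assert (Hrow := geom_dominated_row _ n Hgd). cbv beta in Hrow.
      assert (Hs1 := summable_scal (y * d n) e Hse).
      assert (Hs2 := summable_scal (- (t / x)) _ Hrow).
      rewrite CSeries_head.
      - f_equal.
        + rewrite Nat.add_0_r. unfold f, u, v. rewrite Cpow_mult_l. field; auto.
        + rewrite (CSeries_ext _ _ (Hterm n)).
          rewrite CSeries_plus, !CSeries_scal by assumption. ring.
      - apply (ex_series_incr_1 (V := C_NormedModule)).
        apply (summable_ext _ _ (Hterm n)). now apply summable_plus. }
    assert (Hrows := geom_dominated_sums _ Hgd). cbv beta in Hrows.
    assert (Hs1 := summable_scal (y * CSeries e) d Hsd).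
    assert (Hs2 := summable_scal (- (t / x)) _ Hrows).
    unfold doubleLambert.
    rewrite (CSeries_ext _ _ Hinner).
    rewrite CSeries_plus by (try apply summable_plus; assumption).
    rewrite CSeries_plus, !CSeries_scal by assumption.
    unfold T, CSeries2. ring. }
  rewrite EA1, EA2, EL1, EL2, EL3, EL4, EL5.
  assert (Etri := CSeries2_triangles g Hg). fold T in Etri.
  unfold g at 1 in Etri. rewrite CSeries2_prod in Etri by assumption.
  replace (t / x * CSeries b * CSeries a) with (t / x * (CSeries a * CSeries b)) by ring.
  rewrite Etri. ring.
Qed.
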